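(* Let $m\ge 2$ be an integer, $A=[a]_m$, $B=[b]_m\in\mathbb{Z}_m$ with $a,b\in\mathbb{Z}$, and let $\{F_n\}_{n=0}^\infty$ be a sequence in $\mathbb{Z}_m$. Let $d=\gcd(a,b,m)$ and let $m_1$ be as defined in the context. The equation $$BX_{n+1}=AX_n+F_n,\quad n\in\mathbb{Z}_+,$$ has a unique solution $\{X_n\}_{n=0}^\infty$ in $\mathbb{Z}_m$ if and only if $d=1$ and $m_1=1$. In particular, the homogeneous equation $$BX_{n+1}=AX_n,\quad n\in\mathbb{Z}_+,$$ has only the trivial solution if and only if $d=1$ and $m_1=1$.
   Context: $\mathbb{Z}_+$ is the set of non-negative integers. $\mathbb{Z}_m=\mathbb{Z}/m\mathbb{Z}$ and $[t]_m$ is the class of $t\in\mathbb{Z}$ in $\mathbb{Z}_m$. Write $m=\prod_{j=1}^r p_j^{k_j}$ with distinct primes $p_j$ and integers $k_j\ge1$; then $m_1=\prod_{j:\,p_j\nmid b}p_j^{k_j}$ (an empty product is $1$). *)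

(* Defs.v *)
From mathcomp Require Import all_boot all_order all_algebra.

Set Implicit Arguments.
Unset Strict Implicit.
Unset Printing Implicit Defensive.

Import GRing.Theory.
Local Open Scope ring_scope.

(* The part m_1 of m.  The condition p %| b is tested directly, rather than  *)
(* through \pi(`|b|), because \pi(0) is empty whereas every p divides b = 0. *)
Definition part_prime_to (m : nat) (b : int) : nat :=
  (\prod_(p <- primes m | ~~ (p%:Z %| b)%Z) p ^ logn p m)%N.

Definition is_solution (m : nat) (A B : 'Z_m) (F X : nat -> 'Z_m) : Prop :=
  forall n : nat, B * X n.+1 = A * X n + F n.

(* Sequences are identified when they are pointwise equal. *)
Definition has_unique_solution (m : nat) (A B : 'Z_m) (F : nat -> 'Z_m) : Prop :=
  exists2 X : nat -> 'Z_m,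
    is_solution A B F X & forall Y, is_solution A B F Y -> Y =1 X.

(* Main.v *)
(* With m_1 = 1 the class B is nilpotent, and d = 1 then forces A to be a       *)
(* unit, so X_n = A^-1 (B X_(n+1) - F_n) can be iterated until the unknown      *)
(* disappears.  Conversely, if some prime p %| m does not divide b, or divides  *)
(* both a and b, the class of m / p, which p annihilates, is the initial term   *)
(* of a nontrivial homogeneous solution: a geometric one with ratio a / b       *)
(* mod p in the first case, a constant one in the second.                       *)
Require Import Defs.
From mathcomp Require Import all_boot all_order all_algebra.
From mathcomp Require Import ring.

Import GRing.Theory.
Local Open Scope ring_scope.

(** Both conditions reduce to one test at each prime [p] dividing [m]: [p] divides [b] but not [a]
    ([gcd_part_prime_toP]). Under it, [A - B S], with [S] the shift of sequences, is a unit plus a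
    nilpotent, hence invertible ([homogeneous_trivial], [inhomogeneous_solvable]). If it fails at
    [p], the multiples of [m / p] carry a nonzero homogeneous solution
    ([homogeneous_nontrivial]). *)

Section LinearRecurrence.

Variables (R : comUnitRingType) (A B : R).

Lemma homogeneous_trivial (N : nat) (X : nat -> R) :
    A \is a GRing.unit -> B ^+ N = 0 ->
    (forall n, B * X n.+1 = A * X n) ->
  forall n, X n = 0.
Proof.
move=> uA nilB solX n.
have iterX k : A ^+ k * X n = B ^+ k * X (n + k)%N.
  elim: k => [|k IHk]; first by rewrite !expr0 addn0.
  by rewrite exprS -mulrA IHk addnS exprSr -mulrA solX !mulrA [A * _]mulrC.
apply: (mulrI (unitrX N uA)).
by rewrite iterX nilB mul0r mulr0.
Qed.

(** The witness is minus the Neumann series of [A - B S] inverse, with [S] the shift, applied to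
    [F]; nilpotency of [B] cuts it off at [N] terms. *)
Lemma inhomogeneous_solvable (N : nat) (F : nat -> R) :
    A \is a GRing.unit -> B ^+ N = 0 ->
  exists X : nat -> R, forall n, B * X n.+1 = A * X n + F n.
Proof.
move=> uA nilB.
exists (fun n => - \sum_(k < N) B ^+ k * A ^- k.+1 * F (n + k)%N) => n.
(* Both [A * X n] and [B * X n.+1] are minus sums of [G], shifted by one index; their difference
   telescopes to [G 0 - G N], that is, to [F n]. *)
pose G k := B ^+ k * A ^- k * F (n + k)%N.
have -> : B * - (\sum_(k < N) B ^+ k * A ^- k.+1 * F (n.+1 + k)%N)
          = - \sum_(k < N) G k.+1.
  rewrite mulrN mulr_sumr; congr (- _); apply: eq_bigr => k _.
  by rewrite /G addSnnS (exprS B) !mulrA.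
have -> : A * - (\sum_(k < N) B ^+ k * A ^- k.+1 * F (n + k)%N)
          = - \sum_(k < N) G k.
  rewrite mulrN mulr_sumr; congr (- _); apply: eq_bigr => k _.
  rewrite /G !mulrA exprSr invrM ?unitrX // [A * _]mulrC !mulrA.
  by rewrite -[_ * A * _]mulrA divrr // mulr1.
have : \sum_(k < N) G k + G N = G 0%N + \sum_(k < N) G k.+1.
  transitivity (\sum_(k < N.+1) G k); first by rewrite big_ord_recr.
  by rewrite big_ord_recl.
rewrite [G N]/G nilB !mul0r addr0 [G 0%N]/G addn0 !expr0 invr1 !mul1r => ->.
by rewrite opprD addrAC addNr add0r.
Qed.

End LinearRecurrence.

Section Modular.

Variables (m : nat) (a b : int).
Hypothesis m_gt1 : (1 < m)%N.

Lemma Zp_intr_eq0 (z : int) : ((z%:~R : 'Z_m) == 0) = (m %| `|z|)%N.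
Proof.
have natE n : ((n%:R : 'Z_m) == 0) = (m %| n)%N.
  by rewrite -val_eqE /= val_Zp_nat.
by case: z => n; rewrite ?NegzE ?mulrNz ?oppr_eq0 ?abszN natE.
Qed.

Lemma Zp_intr_unit (z : int) :
  ((z%:~R : 'Z_m) \is a GRing.unit) = coprime m `|z|.
Proof.
by case: z => n; rewrite ?NegzE ?mulrNz ?unitrN ?abszN unitZpE.
Qed.

Lemma part_prime_to_eq1P :
  reflect (forall p, prime p -> (p %| m)%N -> (p %| `|b|)%N)
          (part_prime_to m b == 1%N).
Proof.
have m_gt0 : (0 < m)%N by apply: ltnW.
apply: (iffP eqP) => [m1_1 p p_pr p_m | b0].
  have p_primes : p \in primes m by rewrite mem_primes p_pr m_gt0.
  apply: contraT => pNb.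
  have : (p %| part_prime_to m b)%N.
    rewrite /part_prime_to (big_rem p) //= dvdzE /= pNb.
    by rewrite dvdn_mulr // dvdn_exp // logn_gt0.
  by rewrite m1_1 dvdn1 => /eqP p1; rewrite p1 in p_pr.
rewrite /part_prime_to big_seq_cond big1 // => p /andP[].
by rewrite mem_primes dvdzE /= => /and3P[p_pr _ p_m]; rewrite b0.
Qed.

(** Once every prime factor of [m] divides [b], a prime common to [a], [b] and [m] is just a prime
    common to [a] and [m]. *)
Lemma gcd_part_prime_toP :
  gcdz (gcdz a b) m = 1 /\ part_prime_to m b = 1%N <->
  forall p, prime p -> (p %| m)%N -> (p %| `|b|)%N && ~~ (p %| `|a|)%N.
Proof.
split=> [[d1 /eqP/part_prime_to_eq1P mb] p p_pr p_m | mab].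
  rewrite mb //=; apply/negP => p_a.
  have : (p %| gcdn (gcdn `|a| `|b|) m)%N by rewrite !dvdn_gcd p_a mb.
  by case: d1 => ->; rewrite dvdn1 => /eqP p1; rewrite p1 in p_pr.
split; last first.
  by apply/eqP/part_prime_to_eq1P => p p_pr /(mab p p_pr)/andP[].
congr Posz; apply/eqP; apply: contraT => d_neq1; set d := gcdn _ _ in d_neq1.
have d_gt1 : (1 < d)%N.
  by rewrite ltn_neqAle eq_sym d_neq1 gcdn_gt0 (ltnW m_gt1) orbT.
have := pdiv_dvd d; rewrite {2}/d !dvdn_gcd => /andP[/andP[p_a _] p_m].
by have := mab _ (pdiv_prime d_gt1) p_m; rewrite p_a andbF.
Qed.

Lemma Zp_intr_nilpotent (z : int) :
    (forall p, prime p -> (p %| m)%N -> (p %| `|z|)%N) ->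
  (z%:~R : 'Z_m) ^+ m = 0.
Proof.
move=> mz; apply/eqP; rewrite -rmorphXn /= Zp_intr_eq0 abszX.
apply/dvdn_partP => [|p]; first exact: ltnW.
rewrite mem_primes => /and3P[p_pr m_gt0 p_m].
(* The exponent [m] is large enough because [logn p m < m]. *)
rewrite p_part; apply: dvdn_trans (dvdn_exp2r _ (mz p p_pr p_m)).
by rewrite dvdn_exp2l // ltnW // ltn_logl.
Qed.

Lemma Zp_intr_unit_primes (z : int) :
    (forall p, prime p -> (p %| m)%N -> ~~ (p %| `|z|)%N) ->
  (z%:~R : 'Z_m) \is a GRing.unit.
Proof.
move=> mz; rewrite Zp_intr_unit; apply: contraT => gcd_neq1.
have gcd_gt1 : (1 < gcdn m `|z|)%N.
  by rewrite ltn_neqAle eq_sym gcd_neq1 gcdn_gt0 (ltnW m_gt1).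
have := pdiv_dvd (gcdn m `|z|); rewrite dvdn_gcd => /andP[p_m p_z].
by have := mz _ (pdiv_prime gcd_gt1) p_m; rewrite p_z.
Qed.

Lemma Zp_unit_nilpotent :
    (forall p, prime p -> (p %| m)%N -> (p %| `|b|)%N && ~~ (p %| `|a|)%N) ->
  (a%:~R : 'Z_m) \is a GRing.unit /\ (b%:~R : 'Z_m) ^+ m = 0.
Proof.
move=> mab; split; [apply: Zp_intr_unit_primes | apply: Zp_intr_nilpotent];
  by move=> p p_pr /(mab p p_pr)/andP[].
Qed.

Lemma homogeneous_nontrivial (p : nat) :
    prime p -> (p %| m)%N -> ~~ ((p %| `|b|)%N && ~~ (p %| `|a|)%N) ->
  exists2 X : nat -> 'Z_m,
    forall n, b%:~R * X n.+1 = a%:~R * X n & X 0%N != 0.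
Proof.
move=> p_pr p_m; pose e : 'Z_m := (m %/ p)%N%:Z%:~R.
have e_neq0 : e != 0.
  have m_gt0 : (0 < m)%N by apply: ltnW.
  rewrite Zp_intr_eq0 /=; apply/negP => /dvdn_leq.
  rewrite divn_gt0 ?prime_gt0 // dvdn_leq // => /(_ isT).
  by rewrite leqNgt ltn_Pdiv ?prime_gt1.
have killed z : (p %| `|z|)%N -> z%:~R * e = 0.
  move=> p_z; apply/eqP; rewrite -rmorphM /= Zp_intr_eq0 abszM /=.
  by rewrite -{1}(divnK p_m) mulnC dvdn_mul.
have [p_b /negPn p_a | pNb _] := boolP (p %| `|b|)%N.
  by exists (fun=> e) => // n; rewrite !killed.
(* Bezout gives [u], an inverse of [b] modulo [p]; since [p] kills [e], [b * u] fixes [e]. *)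
have /coprimezP[[u v] /= uv1] : coprimez b p.
  by rewrite coprimezE /= coprime_sym prime_coprime.
have bue : b%:~R * u%:~R * e = e.
  have vpe : (v * p)%:~R * e = 0 by rewrite killed // abszM dvdn_mull.
  by rewrite -intrM [b * u]mulrC -[LHS]addr0 -vpe -mulrDl -intrD uv1 mul1r.
exists (fun n => (a%:~R * u%:~R) ^+ n * e) => [n|]; last by rewrite expr0 mul1r.
by rewrite exprS -[in RHS]bue; ring.
Qed.

Lemma homogeneous_trivialP :
  (forall X : nat -> 'Z_m,
     (forall n, b%:~R * X n.+1 = a%:~R * X n) -> forall n, X n = 0) <->
  forall p, prime p -> (p %| m)%N -> (p %| `|b|)%N && ~~ (p %| `|a|)%N.
Proof.
split=> [triv p p_pr p_m | mab X solX].
  apply: contraT => /(homogeneous_nontrivial _ p_pr p_m)[X solX].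
  by rewrite triv ?eqxx.
have [uA nilB] := Zp_unit_nilpotent mab.
exact: homogeneous_trivial uA nilB solX.
Qed.

(** Solutions form a coset of the homogeneous ones, so uniqueness does not depend on [F]. *)
Lemma unique_solutionP (F : nat -> 'Z_m) :
  has_unique_solution a%:~R b%:~R F <->
  forall p, prime p -> (p %| m)%N -> (p %| `|b|)%N && ~~ (p %| `|a|)%N.
Proof.
split=> [[X solX uniqX] | mab].
  apply/homogeneous_trivialP => Y solY n.
  apply: (addrI (X n)); rewrite addr0.
  apply: (uniqX (fun k => X k + Y k)) => k.
  by rewrite !mulrDr solX solY addrAC.
have [uA nilB] := Zp_unit_nilpotent mab.
have [X solX] := inhomogeneous_solvable _ _ _ _ F uA nilB.
exists X => // Y solY n; apply/eqP; rewrite -subr_eq0; apply/eqP.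
apply: (homogeneous_trivial _ _ _ _ (fun k => Y k - X k) uA nilB) => k.
by rewrite !mulrBr solX solY opprD addrACA subrr addr0.
Qed.

End Modular.

Theorem corollary3p2 (m : nat) (hm : (2 <= m)%N) (a b : int)
    (F : nat -> 'Z_m) :
  let A : 'Z_m := a%:~R in
  let B : 'Z_m := b%:~R in
  let d := gcdz (gcdz a b) m%:Z in
  let m1 := part_prime_to m b in
  (has_unique_solution A B F <-> d = 1 /\ m1 = 1%N) /\
  ((forall X : nat -> 'Z_m,
      (forall n : nat, B * X n.+1 = A * X n) -> forall n : nat, X n = 0)
   <-> d = 1 /\ m1 = 1%N).
Proof.
move=> A B d m1; rewrite (gcd_part_prime_toP _ a b hm).
by split; [apply: unique_solutionP | apply: homogeneous_trivialP].
Qed.
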